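(* Let $n \ge 2$ and let $L$ be a finite-dimensional $n$-Lie algebra over a field $F$. Suppose that every maximal subalgebra of $L$ is an ideal of $L$. Then $L$ is nilpotent.
   Context: An $n$-Lie algebra over a field $F$ is an $F$-vector space $L$ with a linear map $\Lambda^n L \to L$, $x_1\wedge\dots\wedge x_n \mapsto [x_1,\dots,x_n]$ (so the bracket is $n$-linear and alternating), satisfying the generalised Jacobi identity $$[[x_1,\dots,x_n],y_2,\dots,y_n]=\sum_{i=1}^n [x_1,\dots,[x_i,y_2,\dots,y_n],\dots,x_n].$$ For subspaces $A_1,\dots,A_n$ of $L$, $[A_1,\dots,A_n]$ denotes the span of all $[a_1,\dots,a_n]$ with $a_i\in A_i$. A subspace $K$ is a subalgebra if $[K,\dots,K]\subseteq K$ and an ideal if $[K,L,\dots,L]\subseteq K$. A maximal subalgebra is a maximal element (under inclusion) among the proper subalgebras of $L$. $L$ is nilpotent if $L^r=0$ for some $r$, where $L^1=L$ and $L^{s+1}=[L^s,L,\dots,L]$ (with $n-1$ entries $L$). *)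

(* Defs.v *)
From mathcomp Require Import all_boot all_order all_algebra.

Set Implicit Arguments.
Unset Strict Implicit.
Unset Printing Implicit Defensive.

Import GRing.Theory.
Local Open Scope ring_scope.

(* Families indexed by 'I_n: the entry at position 0 plays the role of the
   first argument of the n-ary bracket. *)

Definition upd (T : Type) (n : nat) (x : {ffun 'I_n -> T}) (i : 'I_n) (v : T) :
  {ffun 'I_n -> T} := [ffun j => if j == i then v else x j].

(* (a, y_2, ..., y_n); the entry of y at position 0 is not used. *)
Definition set_first (T : Type) (n : nat) (a : T) (y : {ffun 'I_n -> T}) :
  {ffun 'I_n -> T} := [ffun j : 'I_n => if val j == 0%N then a else y j].

(* A linear map from the n-th exterior power of L to L is given as an n-linear
   map vanishing on families with a repeated entry (so that the definition is
   also the right one in characteristic 2). *)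
Record nLieAlgebra (F : fieldType) (n : nat) (L : vectType F) := NLieAlgebra {
  bracket :> {ffun 'I_n -> L} -> L;
  bracket_linear : forall (x : {ffun 'I_n -> L}) (i : 'I_n) (a : F) (u v : L),
    bracket (upd x i (a *: u + v)) =
      a *: bracket (upd x i u) + bracket (upd x i v);
  bracket_alternating : forall (x : {ffun 'I_n -> L}) (i j : 'I_n),
    i != j -> x i = x j -> bracket x = 0;
  bracket_jacobi : forall x y : {ffun 'I_n -> L},
    bracket (set_first (bracket x) y) =
      \sum_(i < n) bracket (upd x i (bracket (set_first (x i) y)))
}.

Section Subspaces.

Variables (F : fieldType) (n : nat) (L : vectType F) (br : nLieAlgebra n L).
Implicit Types (A : {ffun 'I_n -> {vspace L}}) (K M : {vspace L}).

Definition is_bracket_of A (v : L) : Prop :=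
  exists2 a : {ffun 'I_n -> L}, (forall i, a i \in A i) & v = br a.

Definition in_bracket_span A (v : L) : Prop :=
  exists2 s : seq L, (forall w, w \in s -> is_bracket_of A w) & v \in <<s>>%VS.

Lemma bracket_space_subproof A :
  {U : {vspace L} | forall v, v \in U <-> in_bracket_span A v}.
Proof.
pose b (f : {ffun 'I_n -> 'I_(\dim {:L})}) :=
  [ffun i => (vbasis (A i))`_(f i)] : {ffun 'I_n -> L}.
pose s := [seq br (b f) | f : {ffun 'I_n -> 'I_(\dim {:L})}].
exists <<s>>%VS.
have bA f i : b f i \in A i.
  rewrite ffunE; have [lt_f|ge_f] := ltnP (f i) (size (vbasis (A i))).
    by apply: vbasis_mem; apply: mem_nth.
  by rewrite nth_default ?mem0v.
have brS (a : {ffun 'I_n -> L}) : (forall i, a i \in A i) -> br a \in <<s>>%VS.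
  suff: forall k, (k <= n)%N -> forall x : {ffun 'I_n -> L},
      (forall i, x i \in A i) ->
      (forall i : 'I_n, (k <= i)%N ->
         exists j : 'I_(\dim {:L}), x i = (vbasis (A i))`_j) ->
      br x \in <<s>>%VS.
    by move=> H aA; apply: (H n) => // j; rewrite leqNgt ltn_ord.
  elim=> [|k IHk] lekn x xA xb.
    have /fin_all_exists[f fE] : forall i, exists j : 'I_(\dim {:L}),
      x i = (vbasis (A i))`_j by move=> i; apply: xb.
    have -> : x = b (finfun f) by apply/ffunP=> i; rewrite !ffunE.
    by apply: memv_span; apply: image_f.
  pose i0 := Ordinal lekn.
  have linS c u v : br (upd x i0 u) \in <<s>>%VS ->
      br (upd x i0 v) \in <<s>>%VS -> br (upd x i0 (c *: u + v)) \in <<s>>%VS.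
    by move=> Su Sv; rewrite bracket_linear memvD ?memvZ.
  have S0 : br (upd x i0 0) \in <<s>>%VS.
    have -> : br (upd x i0 0) = 0; last exact: mem0v.
    have := bracket_linear br x i0 (-1) 0 0.
    by rewrite scaler0 addr0 scaleN1r addNr.
  have -> : x = upd x i0 (x i0).
    by apply/ffunP=> j; rewrite ffunE; case: eqP => [->|].
  rewrite [in upd _ _ (x i0)](coord_vbasis (xA i0)).
  apply: (big_ind (fun u => br (upd x i0 u) \in <<s>>%VS)) => //.
    by move=> u v Su Sv; rewrite -[u]scale1r; apply: linS.
  move=> j _; rewrite -[_ *: _]addr0; apply: linS => //.
  apply: IHk => [|i|i leki]; first exact: ltnW.
    rewrite ffunE; case: eqP => [->|_ //].
    by apply: vbasis_mem; apply: mem_nth; rewrite size_tuple.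
  rewrite ffunE; case: eqP => [->|/eqP nei].
    by exists (widen_ord (dimvS (subvf (A i0))) j).
  by apply: xb; rewrite ltn_neqAle leki andbT eq_sym -(inj_eq val_inj) in nei *.
move=> v; split=> [vS|[t tA]].
  by exists s => // w /imageP[f _ ->]; exists (b f).
by apply/subvP/span_subvP => w /tA[a aA ->]; apply: brS.
Qed.

(* [A_1, ..., A_n]: the subspace whose members are the linear combinations of
   brackets [a_1, ..., a_n] with a_i in A_i. *)
Definition bracket_space A : {vspace L} := sval (bracket_space_subproof A).

Lemma bracket_spaceP A v : v \in bracket_space A <-> in_bracket_span A v.
Proof. exact: (svalP (bracket_space_subproof A)). Qed.

(* [K, L, ..., L] *)
Definition bracket_left K : {vspace L} :=
  bracket_space (set_first K [ffun=> fullv]).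

Definition subalgebra K : Prop := (bracket_space [ffun=> K] <= K)%VS.

Definition ideal K : Prop := (bracket_left K <= K)%VS.

Definition proper_subalgebra K : Prop := subalgebra K /\ K <> fullv.

Definition maximal_subalgebra K : Prop :=
  proper_subalgebra K /\
  forall M, proper_subalgebra M -> (K <= M)%VS -> M = K.

(* Indices are shifted by one: lower_central s is L^(s+1). *)
Fixpoint lower_central (s : nat) : {vspace L} :=
  if s is s'.+1 then bracket_left (lower_central s') else fullv.

Definition nilpotent : Prop := exists s, lower_central s = 0%VS.

End Subspaces.

(* Main.v *)
(* For y = (y_2, ..., y_n) let D_y v = [v, y_2, ..., y_n], a derivation that kills
   each y_i. Its Fitting null component N is a subalgebra containing y_2. If N were
   proper, a maximal subalgebra M containing N would be an ideal containing y_2, hence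
   containing the image of D_y, so M would contain both Fitting components. Hence
   every D_y is nilpotent.

   It remains to prove Engel's theorem. As the span of the D_y is not known to
   consist of nilpotent maps, the classical theorem does not apply. Instead one
   inducts on the number of free slots in the maps D_(t_1, ..., t_j, h_(j+1), ...),
   with t fixed and h ranging over a subspace H closed under these maps: H is enlarged
   one vector x at a time, and the maps with x in one slot and H in the others are
   handled by the induction hypothesis for the fixed vectors t_1, ..., t_j, x. *)

From HB Require Import structures.
Require Import Defs.
From mathcomp Require Import all_boot all_order all_algebra.

Set Implicit Arguments.
Unset Strict Implicit.
Unset Printing Implicit Defensive.

Import GRing.Theory.
Local Open Scope ring_scope.

(** * Multilinear algebra of the bracket and its derivations *)

Section Bracket.

Variables (F : fieldType) (n : nat) (L : vectType F) (br : nLieAlgebra n.+1 L).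
Implicit Types (x y z t : {ffun 'I_n.+1 -> L}) (i j k : 'I_n.+1).
Implicit Types (a u v w : L) (A H K U : {vspace L}).

Lemma upd_id x i : upd x i (x i) = x.
Proof. by apply/ffunP=> j; rewrite ffunE; case: eqP => [->|]. Qed.

Lemma updK x i u v : upd (upd x i u) i v = upd x i v.
Proof. by apply/ffunP=> j; rewrite !ffunE; case: eqP. Qed.

Lemma set_first_upd v y : set_first v y = upd y ord0 v.
Proof. by apply/ffunP=> j; rewrite !ffunE. Qed.

Lemma br_upd0 x i : br (upd x i 0) = 0.
Proof.
have := bracket_linear br x i (-1) 0 0.
by rewrite scaler0 addr0 scaleN1r addNr.
Qed.

Lemma br_updD x i u v : br (upd x i (u + v)) = br (upd x i u) + br (upd x i v).
Proof. by rewrite -[u in LHS]scale1r bracket_linear scale1r. Qed.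

Lemma br_updZ x i c u : br (upd x i (c *: u)) = c *: br (upd x i u).
Proof. by rewrite -[c *: u]addr0 bracket_linear br_upd0 addr0. Qed.

Lemma br_eq0 x i : x i = 0 -> br x = 0.
Proof. by move=> xi0; rewrite -(upd_id x i) xi0 br_upd0. Qed.

Lemma br_swap x i j u v : i != j ->
  br (upd (upd x i u) j v) = - br (upd (upd x i v) j u).
Proof.
move=> neij; have updC w w' : upd (upd x i w) j w' = upd (upd x j w') i w.
  apply/ffunP=> k; rewrite !ffunE.
  by case: eqP => // ->; rewrite eq_sym (negPf neij).
have alt w : br (upd (upd x i w) j w) = 0.
  by apply: (@bracket_alternating _ _ _ br _ i j); rewrite // !ffunE eqxx (negPf neij) eqxx.
apply/eqP; rewrite -addr_eq0; apply/eqP.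
have := alt (u + v); rewrite br_updD !updC !br_updD -!updC !alt.
by rewrite add0r addr0 addrC.
Qed.

Definition inner y v : L := br (set_first v y).

Lemma innerE y v : inner y v = br (upd y ord0 v).
Proof. by rewrite /inner set_first_upd. Qed.

Lemma set_first_updC y i u v :
  (0 < i)%N -> set_first v (upd y i u) = upd (set_first v y) i u.
Proof.
rewrite lt0n => nei0; apply/ffunP=> k; rewrite !ffunE.
by case: ifP => // /eqP k0; case: eqP => // ki; rewrite -ki k0 in nei0.
Qed.

Lemma inner_upd y i u v :
  (0 < i)%N -> inner (upd y i u) v = br (upd (set_first v y) i u).
Proof. by move=> i_gt0; rewrite /inner set_first_updC. Qed.

(** Alternation exchanges slots 0 and [i]; hence an ideal, defined through slot 0, absorbs in every
    slot. *)
Lemma inner_swap y i v : (0 < i)%N -> inner y v = - inner (upd y i v) (y i).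
Proof.
move=> i_gt0; have nei0 : ord0 != i by rewrite -val_eqE eq_sym -lt0n.
have eqy : set_first v y = upd (upd y ord0 v) i (y i).
  by rewrite set_first_upd; apply/ffunP=> k; rewrite !ffunE;
    case: (eqVneq k i) => // ->; rewrite eq_sym (negPf nei0).
by rewrite {1}/inner eqy br_swap // -set_first_upd inner_upd.
Qed.

Lemma inner_is_linear y : linear (inner y).
Proof. by move=> c u v; rewrite !innerE bracket_linear. Qed.

HB.instance Definition _ y :=
  GRing.isLinear.Build F L L *:%R (inner y) (inner_is_linear y).

Lemma inner_jacobi x y : inner y (br x) = \sum_i br (upd x i (inner y (x i))).
Proof. exact: bracket_jacobi. Qed.

(** The Jacobi identity as a commutator formula: [inner y] acts on the entries of [z] one at a
    time. *)
Lemma inner_inner y z v : inner y (inner z v) =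
  inner z (inner y v) + \sum_(i < n.+1 | (0 < i)%N) inner (upd z i (inner y (z i))) v.
Proof.
rewrite {2}/inner inner_jacobi (bigD1 ord0) //=; congr (_ + _).
  by rewrite !set_first_upd updK ffunE eqxx -innerE.
apply: eq_big => [i|i]; rewrite -val_eqE -lt0n //= => i_gt0.
by rewrite inner_upd // ffunE /= (gtn_eqF i_gt0).
Qed.

Lemma inner_self y i : (0 < i)%N -> inner y (y i) = 0.
Proof.
move=> i_gt0; rewrite innerE; have nei0 : i != ord0 by rewrite -val_eqE -lt0n.
by apply: (@bracket_alternating _ _ _ br _ i ord0); rewrite // !ffunE (negPf nei0) eqxx.
Qed.

Lemma mem_bracket_space (V : {ffun 'I_n.+1 -> {vspace L}}) x :
  (forall i, x i \in V i) -> br x \in bracket_space br V.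
Proof.
move=> xV; apply/bracket_spaceP; exists [:: br x]; last first.
  by rewrite memv_span ?mem_head.
by move=> w; rewrite inE => /eqP->; exists x.
Qed.

Lemma bracket_space_sub (V : {ffun 'I_n.+1 -> {vspace L}}) U :
  (forall x, (forall i, x i \in V i) -> br x \in U) ->
  (bracket_space br V <= U)%VS.
Proof.
move=> sVU; apply/subvP=> v /bracket_spaceP[s sV vs].
by apply: (subvP _ _ vs); apply/span_subvP=> w /sV[x xV ->]; apply: sVU.
Qed.

Lemma mem_bracket_left K y v : v \in K -> inner y v \in bracket_left br K.
Proof.
move=> Kv; apply: mem_bracket_space => i; rewrite !ffunE.
by case: eqP => // _; rewrite memvf.
Qed.

Lemma bracket_left_sub K U :
  (forall y v, v \in K -> inner y v \in U) -> (bracket_left br K <= U)%VS.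
Proof.
move=> sKU; apply: bracket_space_sub => x xK.
rewrite -(upd_id x ord0) -innerE; apply: sKU.
by have := xK ord0; rewrite !ffunE.
Qed.

Lemma ideal_inner K y i v :
  ideal br K -> (0 < i)%N -> y i \in K -> inner y v \in K.
Proof.
move=> idK i_gt0 Kyi; rewrite (inner_swap _ _ i_gt0) memvN.
by apply: (subvP idK); apply: mem_bracket_left.
Qed.

(* Leibniz' rule by pigeonhole: after s differentiations some argument has been
   differentiated e i times. *)
Lemma iter_inner_br y s (e : 'I_n.+1 -> nat) x :
    (\sum_i e i = s)%N -> (forall i, iter (e i) (inner y) (x i) = 0) ->
  iter s (inner y) (br x) = 0.
Proof.
elim: s e x => [|s IHs] e x e_s ex0.
  apply: (br_eq0 (i := ord0)); have := ex0 ord0.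
  by move/eqP: e_s; rewrite sum_nat_eq0 => /forallP/(_ ord0)/eqP->.
rewrite iterSr inner_jacobi.
have iterD (I : finType) (G : I -> L) :
  iter s (inner y) (\sum_i G i) = \sum_i iter s (inner y) (G i).
  by elim: (s) => //= s' ->; rewrite raddf_sum.
rewrite iterD; apply: big1 => i _.
case ei: (e i) (ex0 i) => [|ei'] exi0.
  (* An exhausted exponent means that this entry is already 0, so its term vanishes. *)
  have xi0 : x i = 0 := exi0.
  rewrite xi0 raddf0 br_upd0.
  by elim: (s) => //= s' ->; rewrite raddf0.
apply: (IHs (fun k => if k == i then ei' else e k)).
  apply/succn_inj; rewrite -e_s (bigD1 i) //= eqxx [RHS](bigD1 i) //= ei.
  by rewrite addSn; congr (_ + _).+1; apply: eq_bigr => k /negPf->.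
by move=> k; rewrite ffunE; case: eqP => // _; rewrite -iterSr.
Qed.

End Bracket.

(** * Fitting decomposition of an endomorphism *)

Section Fitting.

Variables (F : fieldType) (L : vectType F) (f : 'End(L)).

Definition lfun_iter (k : nat) : 'End(L) := iter k (fun g => f \o g)%VF \1%VF.

Lemma lfun_iterE k v : lfun_iter k v = iter k f v.
Proof.
by elim: k => [|k IHk] /=; rewrite ?id_lfunE // comp_lfunE /= -IHk.
Qed.

Lemma mem_lker_iter k v : (v \in lker (lfun_iter k)) = (iter k f v == 0).
Proof. by rewrite memv_ker lfun_iterE. Qed.

Lemma iter0 k : iter k f 0 = 0.
Proof. by elim: k => //= k ->; rewrite raddf0. Qed.

(** The kernels of the iterates increase, and each strict step raises a dimension bounded by that of
    [L]. *)
Lemma lker_iter_stable :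
  exists k, forall m v, iter m f v = 0 -> iter k f v = 0.
Proof.
have stab k : (lker (lfun_iter k.+1) <= lker (lfun_iter k))%VS ->
    forall m v, iter m f v = 0 -> iter k f v = 0.
  move=> /subvP sub; elim=> [v /= ->|m IHm v mv0]; first exact: iter0.
  apply/eqP; rewrite -mem_lker_iter; apply: sub; rewrite mem_lker_iter iterSr.
  by apply/eqP/IHm; rewrite -iterSr.
have: forall c, (exists k, forall m v, iter m f v = 0 -> iter k f v = 0) \/
    exists k, (c <= \dim (lker (lfun_iter k)))%N.
  elim=> [|c [?|[k lek]]]; [by right; exists 0%N | by left |].
  have [/stab ?|nsub] := boolP (lker (lfun_iter k.+1) <= lker (lfun_iter k))%VS.
    by left; exists k.
  right; exists k.+1; apply: leq_ltn_trans lek _.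
  rewrite ltnNge; apply: contra nsub => le_dim.
  have sub : (lker (lfun_iter k) <= lker (lfun_iter k.+1))%VS.
    by apply/subvP=> v; rewrite !mem_lker_iter iterS => /eqP->; rewrite raddf0.
  have /eqP<- : lker (lfun_iter k) == lker (lfun_iter k.+1) by rewrite eqEdim sub.
  exact: subvv.
case/(_ (\dim {:L}).+1) => // -[k]; rewrite ltnNge.
by rewrite dimvS ?subvf.
Qed.

Lemma fitting_null_space : exists2 N : {vspace L},
  (forall v, v \in N <-> exists m, iter m f v = 0) &
  (N + limg f)%VS = fullv.
Proof.
have [k kP] := lker_iter_stable.
have kerE v : v \in lker (lfun_iter k) <-> exists m, iter m f v = 0.
  rewrite mem_lker_iter; split=> [/eqP|[m /kP->]] //.
  by exists k.
(* The exponent k.+1, rather than k, puts the image of the iterate in limg f. *)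
exists (lker (lfun_iter k.+1)).
  move=> v; rewrite mem_lker_iter; split=> [/eqP|[m /kP/= ->]].
    by exists k.+1.
  by rewrite raddf0.
(* Stability of the kernels makes kernel and image meet trivially; rank-nullity then shows that they
   span [L]. *)
have dxI : (lker (lfun_iter k.+1) :&: limg (lfun_iter k.+1))%VS = 0%VS.
  apply/eqP; rewrite -subv0; apply/subvP=> v; rewrite memv_cap mem_lker_iter.
  case/andP=> /eqP v0 /memv_imgP[u _ uE]; move: v0.
  by rewrite uE lfun_iterE -iterD memv0 => /kP /= ->; rewrite raddf0.
apply/eqP; rewrite eqEsubv subvf /=.
have: (lker (lfun_iter k.+1) + limg (lfun_iter k.+1) == fullv)%VS.
  by rewrite eqEdim subvf /= dimv_disjoint_sum // -(limg_ker_dim (lfun_iter k.+1) fullv) capfv.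
move/eqP=> sumE; rewrite -{1}sumE; apply: addvS => //.
by apply/subvP=> v /memv_imgP[u _ ->]; rewrite lfun_iterE /= memv_img ?memvf.
Qed.

End Fitting.

(** * Engel's theorem with some slots fixed *)

Section Engel.

Variables (F : fieldType) (n : nat) (L : vectType F) (br : nLieAlgebra n.+1 L).
Implicit Types (x y z t : {ffun 'I_n.+1 -> L}) (i : 'I_n.+1) (j m : nat).
Implicit Types (a u v w : L) (A H K U : {vspace L}) (B : L -> Prop).

Notation inner := (inner br).

(* The families (t_1, ..., t_j, h_(j+1), ..., h_n) with all h_i in H; position 0
   is left free, and the bracket has n + 1 arguments. *)
Definition completes t j H y : Prop :=
  forall i, (0 < i)%N -> if (i <= j)%N then y i = t i else y i \in H.

Definition stable t j H B : Prop :=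
  forall y v, completes t j H y -> B v -> B (inner y v).

(** Engel's conclusion modulo an invariant subspace [A]. Taking [B] to be a predicate allows
    restriction to the vectors of [B] sent into [A], without building a subspace. *)
Definition engel_property t j H : Prop :=
  forall A B, stable t j H (fun v => v \in A) -> stable t j H B ->
  (exists2 v, B v & v \notin A) ->
  exists v, [/\ B v, v \notin A & forall y, completes t j H y -> inner y v \in A].

Lemma completesS t j H K y : (H <= K)%VS -> completes t j H y -> completes t j K y.
Proof.
move=> /subvP sHK ty i /ty; case: ifP => // _; exact: sHK.
Qed.

Lemma stableS t j H K B : (H <= K)%VS -> stable t j K B -> stable t j H B.
Proof. by move=> sHK st y v /(completesS sHK); apply: st. Qed.

(** * Adjoining one vector to the space of free entries *)

Section OneMoreVector.

Variables (t : {ffun 'I_n.+1 -> L}) (j : nat) (H : {vspace L}) (x0 : L).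
Variable lt_j : (j.+1 < n.+1)%N.
Let p := Ordinal lt_j.
Let t' := upd t p x0.
Let Hx := (H + <[x0]>)%VS.

Lemma completes_updx y : completes t j H y -> completes t' j.+1 H (upd y p x0).
Proof.
move=> ty i i_gt0; rewrite !ffunE -val_eqE /= leq_eqVlt ltnS.
by case: eqP => //= _; apply: ty.
Qed.

(** Multilinear expansion leaves entries in [H] or equal to [x0]. A term with [x0] twice vanishes; a
    single [x0] can be swapped into slot [p]. *)
Lemma completes_add1 v A :
    (forall y, completes t j H y -> inner y v \in A) ->
    (forall y, completes t' j.+1 H y -> inner y v \in A) ->
  forall y, completes t j Hx y -> inner y v \in A.
Proof.
move=> Hv Hxv.
have two y (i k : 'I_n.+1) : (0 < i)%N -> (0 < k)%N -> i != k -> y i = y k -> inner y v = 0.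
  rewrite !lt0n => nei0 nek0 neik yik.
  by apply: (@bracket_alternating _ _ _ br _ i k neik); rewrite !ffunE (negPf nei0) (negPf nek0).
have pure y : (forall i, (0 < i)%N ->
    if (i <= j)%N then y i = t i else y i \in H \/ y i = x0) -> inner y v \in A.
  move=> ty; case: (pickP [pred i : 'I_n.+1 | (j < i)%N && (y i \notin H)]) => [i|noi]; last first.
    apply: Hv => i i_gt0; have := ty i i_gt0; have := noi i; rewrite /= ltnNge.
    by case: ifP => //= _ /negbFE.
  case/andP=> /= lt_ji nHyi; have i_gt0 : (0 < i)%N by apply: leq_trans lt_ji.
  have yi : y i = x0.
    have := ty i i_gt0; rewrite leqNgt lt_ji /= => -[Hyi|//].
    by rewrite Hyi in nHyi.
  case: (pickP [pred k : 'I_n.+1 | [&& k != i, (j < k)%N & y k \notin H]]) => [k|nok].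
    case/and3P=> /= neki lt_jk nHyk; have k_gt0 : (0 < k)%N by apply: leq_trans lt_jk.
    rewrite (two y k i) ?mem0v // yi.
    have := ty k k_gt0; rewrite leqNgt lt_jk /= => -[Hyk|//].
    by rewrite Hyk in nHyk.
  have yH u : u \in H -> completes t j H (upd y i u).
    move=> Hu k k_gt0; have := ty k k_gt0; have := nok k; rewrite /= ffunE.
    case: eqP => [->|] /=; first by rewrite leqNgt lt_ji.
    by rewrite ltnNge; case: ifP => //= _ _ /negbFE.
  have [eq_ip|ne_ip] := eqVneq i p.
    (* Slot [p] is overwritten by [x0], so 0 serves there as a member of [H]. *)
    have -> : y = upd (upd y i 0) p x0 by rewrite -eq_ip updK -yi upd_id.
    by apply/Hxv/completes_updx/yH/mem0v.
  have -> : inner y v = - inner (upd (upd y i (y p)) p x0) v.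
    have {1}-> : y = upd (upd y i x0) p (y p).
      apply/ffunP=> k; rewrite !ffunE; case: eqP => [->|] //.
      by case: eqP => // ->.
    by rewrite !inner_upd // !set_first_updC // br_swap.
  rewrite memvN; apply/Hxv/completes_updx/yH.
  have := nok p; rewrite /= eq_sym ne_ip leqnn /=; exact: negbFE.
(* Induction on [k]: the free slots below [k] still await expansion. *)
have gen k y : (forall i, (0 < i)%N -> if (i <= j)%N then y i = t i else
    if (i < k)%N then (y i \in Hx : Prop) else y i \in H \/ y i = x0) -> inner y v \in A.
  elim: k y => [|k IHk] y ty; first exact: pure.
  have [le_kj|lt_jk] := leqP k j.
    apply: IHk => i /ty; case: (leqP i j) => // lt_ji.
    have lt_ki := leq_ltn_trans le_kj lt_ji.
    by rewrite ltnS leqNgt lt_ki ltnNge (ltnW lt_ki).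
  have [lt_kn|le_nk] := ltnP k n.+1; last first.
    apply: IHk => i /ty; have lt_ik := leq_trans (ltn_ord i) le_nk.
    by rewrite lt_ik ltnS (ltnW lt_ik).
  pose q := Ordinal lt_kn; have q_gt0 : (0 < q)%N by apply: leq_trans lt_jk.
  have := ty q q_gt0; rewrite leqNgt lt_jk /= ltnSn.
  case/memv_addP=> h Hh [_ /vlineP[c ->] yq].
  have IHq u : u \in H \/ u = x0 -> inner (upd y q u) v \in A.
    move=> Hu; apply: IHk => i i_gt0; have := ty i i_gt0; rewrite ffunE -val_eqE /=.
    rewrite ltnS (leq_eqVlt i k); case: eqP => //= ->.
    by rewrite leqNgt lt_jk ltnn.
  rewrite -(upd_id y q) yq inner_upd // br_updD br_updZ -!inner_upd //.
  by rewrite memvD ?memvZ // IHq //; [left | right].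
move=> y ty; apply: (gen n.+1) => i i_gt0; have := ty i i_gt0.
by rewrite ltn_ord.
Qed.


(* For y with one slot equal to x0 and z with entries in H, the commutator of the
   maps of y and z is a sum of maps with entries in H, so the vectors mapped into A
   by H form a stable set. *)
Lemma stable_centralized A B :
    (forall y v, completes t' j.+1 H y -> v \in H -> inner y v \in H) ->
    stable t j Hx (fun v => v \in A) -> stable t j Hx B ->
  stable t' j.+1 H
    (fun v => B v /\ forall y, completes t j H y -> inner y v \in A).
Proof.
move=> closH stA stB y v ty [Bv vA].
have sHHx : (H <= Hx)%VS by apply: addvSl.
have ty' : completes t j Hx y.
  move=> i i_gt0; have := ty i i_gt0; rewrite ffunE -val_eqE /=.
  rewrite leq_eqVlt ltnS; case: eqP => /= [-> ->|_].
    by rewrite ltnn (subvP (addvSr _ _)) ?memv_line.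
  by case: ifP => // _; apply: (subvP sHHx).
split=> [|z tz]; first exact: stB.
have : inner y (inner z v) \in A by apply: stA ty' (vA z tz).
rewrite inner_inner rpredDr //; apply: memv_suml => i i_gt0.
(* In a fixed slot [y] and [z] share the entry [t i], which [inner y] kills; in a free slot the new
   entry stays in [H]. *)
have [le_ij|lt_ji] := leqP i j.
  have := ty i i_gt0; rewrite (leq_trans le_ij) // ffunE -val_eqE /= ltn_eqF ?ltnS // => yi.
  have := tz i i_gt0; rewrite le_ij => ->.
  by rewrite -yi inner_self // inner_upd // br_upd0 mem0v.
apply: vA => k k_gt0; have := tz k k_gt0; rewrite ffunE.
case: eqP => [->|] //; rewrite leqNgt lt_ji /=; exact: closH.
Qed.

(** The vectors of [B] that [H] sends into [A] form a stable set, not inside [A] by [engH]. Applying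
    [engH'] to this set gives one vector that works for both kinds of maps. *)
Lemma engel_add1 :
    engel_property t j H -> engel_property t' j.+1 H ->
    (forall y v, completes t' j.+1 H y -> v \in H -> inner y v \in H) ->
  engel_property t j Hx.
Proof.
move=> engH engH' closH A B stA stB exB.
have sHHx : (H <= Hx)%VS by apply: addvSl.
have [v [Bv nAv vA]] := engH A B (stableS sHHx stA) (stableS sHHx stB) exB.
have stV := stable_centralized closH stA stB.
have stA' : stable t' j.+1 H (fun v => v \in A).
  move=> y w ty Aw.
  have [] // := stable_centralized closH stA stA ty (v := w).
  by split=> // z tz; apply: stA => //; apply: completesS tz.
have [|w [[Bw wA] nAw w'A]] := engH' A _ stA' stV; first by exists v.
by exists w; split=> //; apply: completes_add1.
Qed.

Lemma closed_add1 :
    stable t j H (fun v => v \in H) ->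
    (forall y, completes t j H y -> inner y x0 \in H) ->
  [/\ forall y v, completes t' j.+1 H y -> v \in H -> inner y v \in H
     & stable t j Hx (fun v => v \in Hx)].
Proof.
move=> closH xH.
have closH' y v : completes t' j.+1 H y -> v \in H -> inner y v \in H.
  move=> ty Hv; have p_gt0 : (0 < p)%N by [].
  have yp : y p = x0 by have := ty p p_gt0; rewrite leqnn ffunE eqxx.
  (* Swapping [v] with [x0] gives a map with entries in [H] applied to [x0]. *)
  rewrite (inner_swap _ _ _ p_gt0) memvN yp; apply: xH => i i_gt0.
  have := ty i i_gt0; rewrite !ffunE -val_eqE /= leq_eqVlt ltnS.
  by case: eqP => [->|] /=; rewrite ?ltnn.
split=> // y v ty.
have HHx : (H <= Hx)%VS by apply: addvSl.
case/memv_addP=> h Hh [_ /vlineP[c ->] ->]; rewrite linearD linearZ /= memvD ?memvZ //.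
  by apply: (completes_add1 _ _ ty) => z tz; apply: (subvP HHx); [apply: closH | apply: closH'].
apply: (completes_add1 _ _ ty) => z tz; first exact/(subvP HHx)/xH.
have p_gt0 : (0 < p)%N by [].
have <- : z p = x0 by have := tz p p_gt0; rewrite leqnn ffunE eqxx.
by rewrite inner_self ?mem0v.
Qed.

End OneMoreVector.

Hypothesis inner_nilpotent : forall y, exists k, forall v, iter k (inner y) v = 0.

(** With every slot fixed there is a single map, and it is nilpotent: the last of its iterates on
    [v] outside [A] is the required vector. *)
Lemma engel_full_base t K : engel_property t n K.
Proof.
move=> A B stA stB [v Bv nAv]; have [k /(_ v) tv0] := inner_nilpotent t.
have tE y u : completes t n K y -> inner y u = inner t u.
  move=> ty; congr (br _); apply/ffunP=> i; rewrite !ffunE.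
  case: ifP => // /negbT; rewrite -lt0n => i_gt0.
  by have := ty i i_gt0; rewrite -ltnS ltn_ord.
have tt : completes t n K t by move=> i _; rewrite -ltnS ltn_ord.
have {tv0}: iter k (inner t) v \in A by rewrite tv0 mem0v.
elim: k v Bv nAv => [|k IHk] v Bv nAv; first by rewrite /= (negPf nAv).
rewrite iterSr => tvA; have [tvA1|tvA1] := boolP (inner t v \in A).
  by exists v; split=> // y ty; rewrite tE.
by apply: (IHk (inner t v)) => //; apply: stB.
Qed.

Lemma engel_closed m t j K :
  (j + m)%N = n -> stable t j K (fun v => v \in K) -> engel_property t j K.
Proof.
elim: m t j K => [|m IHm] t j K jm closK.
  by rewrite addn0 in jm; rewrite jm; apply: engel_full_base.
have lt_j : (j.+1 < n.+1)%N by rewrite ltnS -jm addnS leq_addr.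
have grow c : exists H, [/\ (H <= K)%VS, stable t j H (fun v => v \in H),
    engel_property t j H & (c <= \dim H)%N || (K <= H)%VS].
  elim: c => [|c [H [sHK closH engH leH]]].
    (* For [H = 0] slot [j.+1] holds 0, so all the maps vanish. *)
    exists 0%VS; split=> //; first exact: sub0v.
      by move=> y v _; rewrite memv0 => /eqP ->; rewrite linear0 mem0v.
    move=> A B _ _ [v Bv nAv]; exists v; split=> // y ty.
    rewrite /inner (br_eq0 br (i := Ordinal lt_j)) ?mem0v // ffunE /=.
    by have := ty (Ordinal lt_j) isT; rewrite ltnn memv0 => /eqP.
  have [sKH|nsKH] := boolP (K <= H)%VS; first by exists H; rewrite sKH orbT.
  have {leH} leH : (c <= \dim H)%N by rewrite (negPf nsKH) orbF in leH.
  (* Taking [A := H] and [B := K] yields the next vector to adjoin. *)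
  have [|x [Kx nHx xH]] := engH H (fun v => v \in K) closH (stableS sHK closK).
    by have /subvPn := nsKH.
  have [closH' closHx] := closed_add1 lt_j closH xH.
  exists (H + <[x]>)%VS; split=> //; first by rewrite subv_add sHK -memvE.
    by apply: engel_add1 => //; apply: IHm; rewrite // addSnnS.
  apply/orP; left; apply: leq_ltn_trans leH _; rewrite ltnNge; apply: contra nHx => le_dim.
  have /eqP -> : H == (H + <[x]>)%VS by rewrite eqEdim addvSl.
  by rewrite (subvP (addvSr _ _)) ?memv_line.
have [H [sHK _ engH]] := grow (\dim K).+1.
rewrite ltnNge dimvS //= => sKH.
by have /eqP <- : H == K by rewrite eqEsubv sHK.
Qed.

Lemma engel : nilpotent br.
Proof.
(* Induction on the codimension of [A]: Engel gives [v] outside [A] sent into [A], so one more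
   bracket takes [A + <[v]>] into [A]. *)
suff trap c A : (\dim {:L} - \dim A <= c)%N ->
    (forall y v, v \in A -> inner y v \in A) ->
    exists s, (lower_central br s <= A)%VS.
  have [||s sL0] := trap (\dim {:L}) 0%VS; first exact: leq_subr.
    by move=> y v; rewrite memv0 => /eqP ->; rewrite linear0 mem0v.
  by exists s; apply/eqP; rewrite -subv0.
elim: c A => [|c IHc] A dimA idA.
  exists 0%N; have /eqP -> : A == fullv; last exact: subvf.
  by rewrite eqEdim subvf -subn_eq0 -leqn0.
have [sLA|nsLA] := boolP (fullv <= A)%VS; first by exists 0%N.
have compl y : completes [ffun=> 0] 0 fullv y.
  by move=> i; rewrite ltnNge => /negPf ->; rewrite memvf.
have [] := @engel_closed n [ffun=> 0] 0 fullv erefl _ A (fun _ => True).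
- by move=> y v _ _; rewrite memvf.
- by move=> y v _; apply: idA.
- by [].
- by have /subvPn[v _] := nsLA; exists v.
move=> v [_ nAv vA].
have trapAv y u : u \in (A + <[v]>)%VS -> inner y u \in A.
  case/memv_addP=> a Aa [_ /vlineP[b ->] ->].
  rewrite linearD linearZ /=; apply: memvD; first exact: idA.
  exact/memvZ/vA/compl.
have [||s sLAv] := IHc (A + <[v]>)%VS.
- have lt_dim : (\dim A < \dim (A + <[v]>))%N.
    rewrite ltnNge; apply: contra nAv => le_dim.
    have /eqP -> : A == (A + <[v]>)%VS by rewrite eqEdim addvSl.
    by rewrite (subvP (addvSr _ _)) ?memv_line.
  by rewrite -ltnS; apply: leq_trans dimA; rewrite ltn_sub2l // (leq_trans lt_dim) // dimvS ?subvf.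
- by move=> y u /(trapAv y); apply: (subvP (addvSl _ _)).
exists s.+1; apply: bracket_left_sub => y u /(subvP sLAv); exact: trapAv.
Qed.

End Engel.

(** * Nilpotency of the derivations from the hypothesis on maximal subalgebras *)

Section MaximalIdeals.

Variables (F : fieldType) (n : nat) (L : vectType F) (br : nLieAlgebra n.+2 L).
Hypothesis maximal_ideal : forall K : {vspace L}, maximal_subalgebra br K -> ideal br K.

(** Induction on codimension replaces the choice of a maximal subalgebra above [K]: if all larger
    subalgebras are full, a proper [K] is itself maximal. *)
Lemma subalgebra_full (y : {ffun 'I_n.+2 -> L}) (K : {vspace L}) :
    subalgebra br K -> y (inord 1) \in K ->
    (forall U : {vspace L}, (K <= U)%VS -> (forall v, inner br y v \in U) -> U = fullv) ->
  K = fullv.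
Proof.
move=> subK yK KimL.
have [c] := ubnP (\dim {:L} - \dim K); elim: c K subK yK KimL => // c IHc K subK yK KimL dimK.
have [//|/eqP neK] := eqVneq K fullv.
suff idK : ideal br K.
  by apply: KimL => // v; apply: ideal_inner idK _ yK; rewrite inordK.
apply: maximal_ideal; split=> // M [subM neM] sKM.
have [//|neMK] := eqVneq M K; case: neM; apply: IHc => //.
- exact: (subvP sKM).
- by move=> U sMU; apply: KimL; apply: subv_trans sMU.
have lt_dim : (\dim K < \dim M)%N.
  by rewrite ltnNge; apply: contra neMK => le_dim; rewrite eq_sym eqEdim sKM.
rewrite ltnS in dimK; apply: leq_trans dimK.
by rewrite ltn_sub2l // (leq_trans lt_dim) // dimvS ?subvf.
Qed.

Lemma inner_nilpotent_of_maximal (y : {ffun 'I_n.+2 -> L}) :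
  exists k, forall v, iter k (inner br y) v = 0.
Proof.
pose f := linfun (inner br y).
have fE k v : iter k f v = iter k (inner br y) v.
  by elim: k => //= k ->; rewrite lfunE.
have [N NP NI] := fitting_null_space f.
have N_full : N = fullv.
  apply: (subalgebra_full (y := y)).
  - apply: bracket_space_sub => x xN.
    have /fin_all_exists[e eE] : forall i, exists e, iter e (inner br y) (x i) = 0.
      move=> i; have /NP[e] : x i \in N by have := xN i; rewrite ffunE.
      by rewrite fE; exists e.
    apply/NP; exists (\sum_i e i)%N; rewrite fE; exact: (iter_inner_br (e := e)).
  - by apply/NP; exists 1%N; rewrite fE /= inner_self // inordK.
  move=> U sNU imU; apply/eqP; rewrite eqEsubv subvf -NI subv_add sNU.
  by apply/subvP=> v /memv_imgP[u _ ->]; rewrite lfunE imU.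
(* Each vector has its own exponent; stability of the kernels makes it uniform. *)
have [k kP] := lker_iter_stable f; exists k => v.
by have /NP[m /kP] : v \in N; [rewrite N_full memvf | rewrite fE].
Qed.

End MaximalIdeals.

Theorem theorem3p4 (F : fieldType) (n : nat) (hn : (2 <= n)%N)
    (L : vectType F) (br : nLieAlgebra n L) :
  (forall K : {vspace L}, maximal_subalgebra br K -> ideal br K) ->
  nilpotent br.
Proof.
case: n hn br => [//|[//|n]] _ br maxI.
by apply: engel => y; apply: inner_nilpotent_of_maximal.
Qed.
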